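(* In the Stone space $\mathrm{st}(P(\omega)/\triangle_d)$ there exists a weak $P$-point.
   Context: $\omega$ is the set of non-negative integers. For $A\subseteq\omega$, $d_*(A)=\liminf_{n\to\infty}\frac{|A\cap n|}{n}$ and $d^*(A)=\limsup_{n\to\infty}\frac{|A\cap n|}{n}$ (where $n=\{0,\dots,n-1\}$) are the lower and upper asymptotic density; if they are equal, the common value $d(A)$ is the asymptotic density of $A$. $\triangle_d$ is the ideal of subsets of $\omega$ of asymptotic density zero, and $P(\omega)/\triangle_d$ is the quotient Boolean algebra. $\mathrm{st}(\mathbb{A})$ denotes the Stone space of the Boolean algebra $\mathbb{A}$. A point $p$ of a topological space $X$ is a weak $P$-point if $p$ is not a limit point of any countable subset of $X\setminus\{p\}$. *)

(* Defs.v *)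
From HB Require Import structures.
From mathcomp Require Import all_boot all_order all_algebra.
From mathcomp Require Import all_classical all_reals all_analysis.
Import Order.TTheory GRing.Theory Num.Theory.
Import numFieldNormedType.Exports.

Set Implicit Arguments.
Unset Strict Implicit.
Unset Printing Implicit Defensive.

Local Open Scope classical_set_scope.
Local Open Scope quotient_scope.

Record set_ideal (T : Type) := SetIdeal {
  ideal_sets :> set T -> Prop;
  ideal0 : ideal_sets set0;
  idealS : forall A B : set T, A `<=` B -> ideal_sets B -> ideal_sets A;
  idealU : forall A B : set T,
    ideal_sets A -> ideal_sets B -> ideal_sets (A `|` B) }.

(* [`+`] is the symmetric difference. *)
Definition ideal_rel (T : Type) (I : set_ideal T) : rel (set T) :=
  fun A B => `[< I (A `+` B) >].

Section IdealQuotient.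
Variables (T : Type) (I : set_ideal T).
Implicit Types A B C : set T.

Lemma ideal_rel_refl : reflexive (ideal_rel I).
Proof. by move=> A; apply/asboolP; rewrite setYK; exact: ideal0. Qed.

Lemma ideal_rel_sym : symmetric (ideal_rel I).
Proof. by move=> A B; rewrite /ideal_rel setYC. Qed.

Lemma ideal_rel_trans : transitive (ideal_rel I).
Proof.
move=> B A C /asboolP AB /asboolP BC; apply/asboolP.
apply: idealS (idealU AB BC) => x; rewrite !setYE /=.
by have [|] := pselect (A x); have [|] := pselect (B x);
  have [|] := pselect (C x); tauto.
Qed.

Canonical ideal_equiv :=
  EquivRel (ideal_rel I) ideal_rel_refl ideal_rel_sym ideal_rel_trans.

End IdealQuotient.

Definition ideal_quot (T : Type) (I : set_ideal T) := {eq_quot (ideal_equiv I)}.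

Fact ideal_quot_display : Order.disp_t. Proof. exact: Order.Disp tt tt. Qed.

Section IdealQuotientAlgebra.
Variables (T : Type) (I : set_ideal T).
Local Notation Q := (ideal_quot I).
Implicit Types (A B C : set T) (x y z : Q).

HB.instance Definition _ := EqQuotient.on Q.
HB.instance Definition _ := Choice.on Q.

Definition iq_meet : Q -> Q -> Q := lift_op2 Q (@setI T).
Definition iq_join : Q -> Q -> Q := lift_op2 Q (@setU T).
Definition iq_compl : Q -> Q := lift_op1 Q (@setC T).
Definition iq_bot : Q := lift_cst Q (@set0 T).
Definition iq_top : Q := lift_cst Q (@setT T).

Lemma iq_eqP A B : reflect (\pi_Q A = \pi_Q B) `[< I (A `+` B) >].
Proof. by apply: (iffP idP) => [h|/eqmodP//]; exact/eqmodP. Qed.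

Lemma pi_iq_meet : {morph \pi_Q : A B / A `&` B >-> iq_meet A B}.
Proof.
move=> A B; unlock iq_meet; apply/iq_eqP/asboolP.
have /iq_eqP/asboolP hA : \pi_Q A = \pi_Q (repr (\pi_Q A)) by rewrite reprK.
have /iq_eqP/asboolP hB : \pi_Q B = \pi_Q (repr (\pi_Q B)) by rewrite reprK.
apply: idealS (idealU hA hB) => t; rewrite !setYE /=.
by have [|] := pselect (A t); have [|] := pselect (B t);
  have [|] := pselect (repr (\pi_Q A) t);
  have [|] := pselect (repr (\pi_Q B) t); tauto.
Qed.
Canonical pi_iq_meet_morph := PiMorph2 pi_iq_meet.

Lemma pi_iq_compl : {morph \pi_Q : A / ~` A >-> iq_compl A}.
Proof.
move=> A; unlock iq_compl; apply/iq_eqP/asboolP.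
have /iq_eqP/asboolP hA : \pi_Q A = \pi_Q (repr (\pi_Q A)) by rewrite reprK.
apply: idealS hA => t; rewrite !setYE /=.
by have [|] := pselect (A t); have [|] := pselect (repr (\pi_Q A) t); tauto.
Qed.
Canonical pi_iq_compl_morph := PiMorph1 pi_iq_compl.

Lemma pi_iq_join : {morph \pi_Q : A B / A `|` B >-> iq_join A B}.
Proof.
move=> A B; unlock iq_join; apply/iq_eqP/asboolP.
have /iq_eqP/asboolP hA : \pi_Q A = \pi_Q (repr (\pi_Q A)) by rewrite reprK.
have /iq_eqP/asboolP hB : \pi_Q B = \pi_Q (repr (\pi_Q B)) by rewrite reprK.
apply: idealS (idealU hA hB) => t; rewrite !setYE /=.
by have [|] := pselect (A t); have [|] := pselect (B t);
  have [|] := pselect (repr (\pi_Q A) t);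
  have [|] := pselect (repr (\pi_Q B) t); tauto.
Qed.
Canonical pi_iq_join_morph := PiMorph2 pi_iq_join.

Canonical pi_iq_bot_morph := PiConst iq_bot.
Canonical pi_iq_top_morph := PiConst iq_top.

Lemma iq_meetC : commutative iq_meet.
Proof. by elim/quotW=> A; elim/quotW=> B; rewrite !piE setIC. Qed.
Lemma iq_joinC : commutative iq_join.
Proof. by elim/quotW=> A; elim/quotW=> B; rewrite !piE setUC. Qed.
Lemma iq_meetA : associative iq_meet.
Proof.
by elim/quotW=> A; elim/quotW=> B; elim/quotW=> C; rewrite !piE setIA.
Qed.
Lemma iq_joinA : associative iq_join.
Proof.
by elim/quotW=> A; elim/quotW=> B; elim/quotW=> C; rewrite !piE setUA.
Qed.
Lemma iq_joinKI y x : iq_meet x (iq_join x y) = x.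
Proof.
by elim/quotW: x => A; elim/quotW: y => B; rewrite !piE setUC setKU.
Qed.
Lemma iq_meetKU y x : iq_join x (iq_meet x y) = x.
Proof.
by elim/quotW: x => A; elim/quotW: y => B; rewrite !piE setIC setKI.
Qed.
Lemma iq_meetUl : left_distributive iq_meet iq_join.
Proof.
by elim/quotW=> A; elim/quotW=> B; elim/quotW=> C; rewrite !piE setIUl.
Qed.
Lemma iq_meetxx : idempotent_op iq_meet.
Proof. by elim/quotW=> A; rewrite !piE setIid. Qed.

HB.instance Definition _ := Order.isMeetJoinDistrLattice.Build
  ideal_quot_display Q
  (fun _ _ => erefl) (fun _ _ => erefl) iq_meetC iq_joinC iq_meetA iq_joinA
  iq_joinKI iq_meetKU iq_meetUl iq_meetxx.

Lemma iq_le0x x : (iq_bot <= x)%O.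
Proof.
by elim/quotW: x => A; apply/eqP; rewrite !piE set0I.
Qed.

Lemma iq_lex1 x : (x <= iq_top)%O.
Proof.
by elim/quotW: x => A; apply/eqP; rewrite !piE setIT.
Qed.

HB.instance Definition _ :=
  Order.hasBottom.Build ideal_quot_display Q iq_le0x.
HB.instance Definition _ :=
  Order.hasTop.Build ideal_quot_display Q iq_lex1.

Lemma iq_joinxC x : iq_join x (iq_compl x) = iq_top.
Proof. by elim/quotW: x => A; rewrite !piE setUv. Qed.

Lemma iq_meetxC x : iq_meet x (iq_compl x) = iq_bot.
Proof. by elim/quotW: x => A; rewrite !piE setICr. Qed.

HB.instance Definition _ := Order.TBDistrLattice_hasComplement.Build
  ideal_quot_display Q iq_joinxC iq_meetxC.

End IdealQuotientAlgebra.

Section Density.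
Variable R : realType.
Implicit Types A B : set nat.
Local Open Scope ring_scope.

(* |A \cap n| / n; the junk value 0 at n = 0 is irrelevant for the limits. *)
Definition density_seq A (n : nat) : R :=
  #|[pred i : 'I_n | (i : nat) \in A]|%:R / n%:R.

Definition lower_density A : \bar R := limn_einf (EFin \o density_seq A).

Definition upper_density A : \bar R := limn_esup (EFin \o density_seq A).

Definition has_density A (d : R) :=
  lower_density A = d%:E /\ upper_density A = d%:E.

Lemma has_densityP A d : has_density A d <-> density_seq A @ \oo --> d.
Proof.
set u := EFin \o density_seq A.
rewrite /has_density /lower_density /upper_density -/u; split; last first.
  move=> Ad; have ud : u @ \oo --> d%:E by apply/fine_cvgP; split=> //; near=> n.
  by have [-> ->] := cvg_limn_einf_sup ud.
rewrite limn_einf_lim limn_esup_lim => -[ld ud].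
have il : einfs u @ \oo --> d%:E by rewrite -ld; exact: is_cvg_einfs.
have ul : esups u @ \oo --> d%:E by rewrite -ud; exact: is_cvg_esups.
have : u @ \oo --> d%:E.
  apply: (squeeze_cvge _ il ul); near=> n; apply/andP; split.
    by apply: ereal_inf_lbound; exists n => //=.
  by apply: ereal_sup_ubound; exists n => //=.
by move/fine_cvgP => [].
Unshelve. all: by end_near.
Qed.

Lemma density_zeroP A : has_density A 0 <->
  forall e : R, 0 < e -> \forall n \near \oo, density_seq A n <= e.
Proof.
rewrite has_densityP; split.
  move=> /cvgrPdist_le A0 e /A0; apply: filterS => n; rewrite sub0r normrN.
  exact: le_trans (ler_norm _).
move=> A0; apply/cvgrPdist_le => e /A0; apply: filterS => n.
by rewrite sub0r normrN ger0_norm ?divr_ge0.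
Qed.

Lemma density0_set0 : has_density set0 0.
Proof.
apply/density_zeroP => e e0; near=> n.
rewrite /density_seq (eq_card0 (A := [pred i : 'I_n | _])) ?mul0r ?ltW//.
by move=> i; rewrite !inE in_set0.
Unshelve. all: by end_near.
Qed.

Lemma density0S A B : A `<=` B -> has_density B 0 -> has_density A 0.
Proof.
move=> AB /density_zeroP B0; apply/density_zeroP => e /B0.
apply: filterS => n; apply: le_trans; rewrite ler_wpM2r ?invr_ge0// ler_nat.
apply/subset_leq_card/fintype.subsetP => i; rewrite !inE; exact: AB.
Qed.

Lemma density0U A B :
  has_density A 0 -> has_density B 0 -> has_density (A `|` B) 0.
Proof.
move=> /density_zeroP A0 /density_zeroP B0; apply/density_zeroP => e e0.
have e20 : 0 < e / 2 by rewrite divr_gt0.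
apply: filterS2 (A0 _ e20) (B0 _ e20) => n An Bn.
rewrite [e]splitr; apply: le_trans (lerD An Bn).
rewrite -mulrDl -natrD ler_wpM2r ?invr_ge0// ler_nat -cardUI.
apply: leq_trans (leq_addr _ _).
by apply/subset_leq_card/fintype.subsetP => i; rewrite !inE => -[xA|xB]; apply/orP; [left|right]; apply/mem_set.
Qed.

Definition density_zero_ideal : set_ideal nat :=
  SetIdeal density0_set0 density0S density0U.

End Density.

(* A ctbDistrLatticeType (complemented distributive lattice with 0 and 1) is a
   Boolean algebra; ultrafilters of B are the points of its Stone space. *)
Section Stone.
Context {d : Order.disp_t} {B : ctbDistrLatticeType d}.
Local Open Scope order_scope.

Record is_ultrafilter (F : set B) : Prop := IsUltrafilter {
  ultra_top : F \top;
  ultra_bot : ~ F \bot;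
  ultra_meet : forall a b, F a -> F b -> F (a `&` b);
  ultra_up : forall a b, a <= b -> F a -> F b;
  ultra_compl : forall a, F a \/ F (~` a) }.

End Stone.

Record stone d (B : ctbDistrLatticeType d) := Stone {
  stone_filter :> set B;
  stone_ultra : is_ultrafilter stone_filter }.

(* An alias of B carrying the pointed structure that the topological base
   factory requires of its index type. *)
Definition stone_index d (B : ctbDistrLatticeType d) : Type := B.

HB.instance Definition _ d (B : ctbDistrLatticeType d) :=
  Choice.on (stone_index B).
HB.instance Definition _ d (B : ctbDistrLatticeType d) :=
  isPointed.Build (stone_index B) (\bot%O : B).

Section StoneTopology.
Context {d : Order.disp_t} (B : ctbDistrLatticeType d).

HB.instance Definition _ := gen_eqMixin (stone B).
HB.instance Definition _ := gen_choiceMixin (stone B).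

Definition stone_clopen (a : B) : set (stone B) :=
  [set p : stone B | stone_filter p a].

Lemma stone_clopen_cover :
  \bigcup_(a in [set: stone_index B]) stone_clopen a = [set: stone B].
Proof.
by apply/seteqP; split=> // p _; exists \top%O => //; case: p => F [].
Qed.

Lemma stone_clopen_join (a b : stone_index B) (p : stone B) :
  setT a -> setT b -> stone_clopen a p -> stone_clopen b p ->
  exists c : stone_index B, [/\ setT c, stone_clopen c p &
    stone_clopen c `<=` stone_clopen a `&` stone_clopen b].
Proof.
move=> _ _ pa pb; exists (Order.meet (a : B) b); split=> //.
  exact: ultra_meet (stone_ultra p) _ _ pa pb.
move=> q qab; split; apply: ultra_up (stone_ultra q) _ _ _ qab.
  exact: leIl.
exact: leIr.
Qed.

HB.instance Definition _ :=
  isBaseTopological.Build (stone B) stone_clopen_cover stone_clopen_join.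

End StoneTopology.

Definition weak_P_point (X : topologicalType) (p : X) : Prop :=
  forall D : set X, D `<=` [set~ p] -> countable D -> ~ limit_point D p.

(* Main.v *)
Require Import Defs.
From mathcomp Require Import all_boot all_order all_algebra.
From mathcomp Require Import all_classical all_reals all_analysis.

(** The point is built by Kunen's method for OK points, carried out modulo an
    ideal [J] on the natural numbers.

    A point [p] is a weak P-point as soon as for every sequence [U] of members
    of [p] there are members [V a] of [p], with [a] ranging over an uncountable
    set, such that any [m + 1] of the [V a] intersect, modulo [J], inside
    [U 0 `&` ... `&` U m].  Indeed, given points [q 0, q 1, ...] other than
    [p], choose [U n] in [p] and outside [q n].  At most [n] of the [V a] lie
    in [q n], so only countably many [a] have [V a] in some [q n], and
    any other [V a] gives a neighbourhood of [p] that avoids every [q n]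
    ([weak_P_of_linked]).

    Such a [p] is obtained by transfinite recursion over the sequences [U]
    ([exists_deciding_family]).  The fuel is a matrix [A i a m] whose rows [i]
    are independent of each other and whose entries in one row are linked: any
    [m + 1] of the sets [A i a m] meet in a set of [J], while any finite number
    [m] of them is compatible with everything chosen in finitely many other
    rows.  One step ([decide_step]) uses up finitely many rows.  Either some
    [U 0 `&` ... `&` U n] is contradicted by finitely many rows, and its
    complement can be added after dropping those rows; or all these
    intersections stay compatible with the matrix, and one row allows [V a] to
    be glued from the pieces of [A i a m] on the successive layers of [U].  In
    this way each sequence is settled once and for all; constant sequences make
    the resulting family generate an ultrafilter.  A new row is always
    available because the recursion follows a well-order with short initial
    segments and the rows are indexed by sequences of sequences: a diagonal
    argument as in Konig's theorem avoids all the rows already spent.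

    The matrix is Kunen's, on a countable set of nodes, transported to [J]
    along a level map whose preimages of finite sets are in [J] and whose
    preimages of infinite sets are not ([linked_family]).  For the ideal of sets
    of density zero the level of [n] is its binary logarithm: a finite set of
    levels is bounded, whereas a set that contains a full level
    [[2 ^ j, 2 ^ j.+1)] has density at least 1/2 at [2 ^ j.+1]. *)

Import Order.TTheory GRing.Theory Num.Theory.

Set Implicit Arguments.
Unset Strict Implicit.
Unset Printing Implicit Defensive.

Local Open Scope classical_set_scope.

(** * Independent linked families *)

(** The level used in row [i] is the number of columns chosen there, which is
    the largest intersection that [linked_small] does not make small.  As [phi]
    is total, two choices on disjoint sets of rows are merged by a case
    distinction. *)
Definition cell (K L : eqType) (A : K -> L -> nat -> set nat)
    (r : seq K) (phi : K -> seq L) : set nat :=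
  [set x | forall i, i \in r -> forall a, a \in phi i -> A i a (size (phi i)) x].

Record independent_linked (J : set_ideal nat) (K L : eqType)
    (A : K -> L -> nat -> set nat) : Prop := IndependentLinked {
  linked_mono : forall i a m n, (m <= n)%N -> A i a m `<=` A i a n;
  linked_small : forall i m (s : seq L), uniq s -> (m < size s)%N ->
    J (\bigcap_(a in [set` s]) A i a m);
  linked_cell : forall r phi, ~ J (cell A r phi) }.

Section Prefix.
Variable C : countType.
Implicit Types X Y : set C.

(** The trace of [X] on the points of [C] coded below [k]. *)
Definition initial_bits k X : {ffun 'I_k -> bool} :=
  [ffun j : 'I_k => oapp (fun c => `[< X c >]) false (unpickle j)].

Lemma initial_bits_neq X Y : X <> Y ->
  exists k0, forall k, (k0 <= k)%N -> initial_bits k X <> initial_bits k Y.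
Proof.
move=> XY; have [c XYc] : exists c, ~ (X c <-> Y c).
  apply: contrapT => /forallNP XYc; apply: XY; apply/seteqP.
  by split=> c; have /contrapT := XYc c; tauto.
exists (pickle c).+1 => k ck eqk.
have := congr1 (fun f : {ffun 'I_k -> bool} => f (Ordinal ck)) eqk.
rewrite !ffunE /= pickleK /= => eqc; apply: XYc.
by split=> /asboolP Zc; apply/asboolP; congruence.
Qed.

Lemma initial_bits_inj (s : seq (set C)) :
  exists k0, forall k, (k0 <= k)%N -> {in s &, injective (initial_bits k)}.
Proof.
have pairP (u : set C * set C) :
    exists k0, forall k, (k0 <= k)%N ->
      initial_bits k u.1 = initial_bits k u.2 -> u.1 = u.2.
  have [->|/eqP/initial_bits_neq[k0 k0P]] := eqVneq u.1 u.2; first by exists 0.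
  by exists k0 => k /k0P.
have [b bP] := choice pairP.
exists (\max_(u <- [seq (X, Y) | X <- s, Y <- s]) b u) => k kP X Y Xs Ys.
apply: (bP (X, Y)); apply: leq_trans kP.
have XYs : (X, Y) \in [seq (X, Y) | X <- s, Y <- s] by exact: allpairs_f.
exact: (@leq_bigmax_seq _ _ predT b _ XYs isT).
Qed.

End Prefix.

Section KunenMatrix.
Variables C D : countType.

(** A predictor of level [k] sees the initial bits of a row and answers with a
    set of guesses for the initial bits of a column. *)
Definition predictor k :=
  {ffun {ffun 'I_k -> bool} -> {set {ffun 'I_k -> bool}}}.
Definition node := {k : nat & predictor k}.

(** Row [X] and column [Y]: the predictor makes at most [m] guesses on [X], and
    one of them is right about [Y]. *)
Definition kunen (X : set C) (Y : set D) (m : nat) : set node :=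
  [set x : node | (#|tagged x (initial_bits (tag x) X)| <= m)%N /\
           initial_bits (tag x) Y \in tagged x (initial_bits (tag x) X)].

Lemma finite_node_lt k0 : finite_set [set x : node | (tag x < k0)%N].
Proof.
apply: (@sub_finite_set _ _
  (\bigcup_(k in `I_k0) (Tagged predictor @` [set: predictor k]))).
  by move=> [k f] /= kk0; exists k => //; exists f.
by apply: bigcup_finite => // k _; apply: finite_image; exact: finite_finset.
Qed.

(** Past the level where the initial bits separate the columns in [s], the
    columns need [size s > m] different guesses; only finitely many nodes lie
    below that level. *)
Lemma kunen_small X m (s : seq (set D)) : uniq s -> (m < size s)%N ->
  finite_set (\bigcap_(Y in [set` s]) kunen X Y m).
Proof.
move=> us ms; have [k0 k0P] := initial_bits_inj s.
have s0 : 0 < size s by apply: leq_ltn_trans ms.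
apply: (sub_finite_set _ (finite_node_lt k0)) => -[k f] fP /=.
rewrite ltnNge; apply/negP => /k0P kinj.
have fm : (#|f (initial_bits k X)| <= m)%N.
  by have [] := fP (nth set0 s 0) (mem_nth _ s0).
have : (size (map (initial_bits k) s) <= #|f (initial_bits k X)|)%N.
  rewrite -(card_uniqP _) ?map_inj_in_uniq//.
  apply/subset_leq_card/fintype.subsetP => _ /mapP[Y Ys ->].
  by have [] := fP Y Ys.
by rewrite size_map leqNgt (leq_ltn_trans fm ms).
Qed.

Definition interpolator (r : seq (set C)) (phi : set C -> seq (set D)) k :
    predictor k :=
  [ffun u => [set v | has (fun X => (initial_bits k X == u) &&
     (v \in map (initial_bits k) (phi X))) r]%SET].

(** Once the initial bits separate the rows in [r], the guesses required by
    [phi] on different rows do not interfere, which is what makes the rows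
    independent. *)
Lemma kunen_interpolator r phi : exists k0, forall k, (k0 <= k)%N ->
  forall X, X \in r -> forall Y, Y \in phi X ->
  kunen X Y (size (phi X)) (Tagged predictor (interpolator r phi k)).
Proof.
have [k0 k0P] := initial_bits_inj r; exists k0 => k /k0P kinj X Xr Y YX.
have -> : kunen X Y (size (phi X)) (Tagged predictor (interpolator r phi k)) =
    ((#|interpolator r phi k (initial_bits k X)| <= size (phi X))%N /\
     initial_bits k Y \in interpolator r phi k (initial_bits k X)) by [].
have -> : interpolator r phi k (initial_bits k X) =
    [set v in map (initial_bits k) (phi X)]%SET.
  apply/setP => v; rewrite ffunE !inE; apply/hasP/idP.
    by move=> [Z Zr /andP[/eqP /(kinj _ _ Zr Xr) ->]].
  by move=> vX; exists X => //; rewrite eqxx.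
split; last by rewrite inE map_f.
by rewrite cardsE -(size_map (initial_bits k)) card_size.
Qed.

(** The matrix lives on the nodes; a natural number belongs to an entry when its
    level is the code of a node of that entry.  Finite and infinite sets of
    nodes thus become sets inside and outside [J]. *)
Lemma linked_family (J : set_ideal nat) (lvl : nat -> nat) :
    (forall S, finite_set S -> J (lvl @^-1` S)) ->
    (forall S, infinite_set S -> ~ J (lvl @^-1` S)) ->
  exists A : set C -> set D -> nat -> set nat, independent_linked J A.
Proof.
move=> Jfin Jinf.
pose code (B : set node) : set nat := pickle @` B.
exists (fun X Y m => lvl @^-1` code (kunen X Y m)); split.
- move=> X Y m n mn x [y [ym yY] yx]; exists y => //; split=> //.
  exact: leq_trans ym mn.
- move=> X m s us ms.
  have fin : finite_set (code (\bigcap_(Y in [set` s]) kunen X Y m)).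
    by apply: finite_image; exact: kunen_small.
  apply: idealS (Jfin _ fin) => x xP.
  have s0 : 0 < size s by apply: leq_ltn_trans ms.
  have [y _ yx] := xP _ (mem_nth set0 s0).
  exists y => // Y /xP[z zP]; rewrite -yx => /(pcan_inj pickleK) <-//.
- move=> r phi; have [k0 k0P] := kunen_interpolator r phi.
  pose w k : nat :=
    pickle (Tagged predictor (interpolator r phi (k0 + k)) : node).
  (* one interpolating node per level, hence infinitely many *)
  have winj : injective w.
    by move=> k l /(pcan_inj pickleK) /(congr1 tag) /= /addnI.
  have : infinite_set (range w).
    move=> /(finite_preimage (f := w)); rewrite preimage_range => fin.
    by apply: infinite_nat; apply: fin => k l _ _; exact: winj.
  move=> /Jinf; apply: contra_not; apply: idealS => x [k _ kx] X Xr Y YX.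
  by exists (Tagged predictor (interpolator r phi (k0 + k))) => //;
    apply: k0P => //; rewrite leq_addr.
Qed.

End KunenMatrix.

(** * One step of the construction *)

Definition finmeet (T : Type) (e : seq (set T)) : set T :=
  \bigcap_(X in [set` e]) X.

Definition sub_seq (T : eqType) (e : seq T) (E : set T) : Prop :=
  forall x, x \in e -> E x.

(** The invariant of the recursion: the rows in [F] are still independent over
    the filter generated by [E] and the complements of sets in [J]. *)
Definition compatible (J : set_ideal nat) (K L : eqType)
    (A : K -> L -> nat -> set nat) (E : set (set nat)) (F : set K) : Prop :=
  forall e r phi, sub_seq e E -> sub_seq r F ->
    ~ J (finmeet e `&` cell A r phi).

Definition initial_meet (U : nat -> set nat) (n : nat) : set nat :=
  \bigcap_(j in `I_n.+1) U j.

Definition linked_below (J : set_ideal nat) (L : eqType)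
    (U : nat -> set nat) (V : L -> set nat) : Prop :=
  forall m (s : seq L), uniq s -> (m < size s)%N ->
    J (\bigcap_(a in [set` s]) V a `\` initial_meet U m).

(** The first alternative prevents [U] from being a sequence of members of any
    filter containing [E]; the second provides the neighbourhoods that Kunen's
    OK property requires for [U]. *)
Definition decides (J : set_ideal nat) (L : eqType) (E : set (set nat))
    (U : nat -> set nat) : Prop :=
  (exists n, E (~` initial_meet U n)) \/
  (exists2 V : L -> set nat, forall a, E (V a) & linked_below J U V).

Section Step.
Variables (J : set_ideal nat) (K L : eqType) (A : K -> L -> nat -> set nat).
Hypothesis AJ : independent_linked J A.
Implicit Types (E : set (set nat)) (F : set K) (U : nat -> set nat).

Lemma initial_meet_anti U m n :
  (m <= n)%N -> initial_meet U n `<=` initial_meet U m.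
Proof. by move=> mn x xn j jm; apply: xn; exact: leq_trans jm _. Qed.

(** If adding [~` S] also broke the remaining rows, then both [S] and [~` S]
    would be in conflict with finitely many rows, taken from two disjoint sets
    of rows; merging the two choices contradicts compatibility of [E]. *)
Lemma add_complement E F S e r phi : compatible J A E F ->
    sub_seq e E -> sub_seq r F -> J (finmeet e `&` cell A r phi `&` S) ->
  compatible J A (E `|` [set ~` S]) (F `\` [set` r]).
Proof.
move=> EF eE rF eS e1 r1 phi1 e1E r1F J1.
pose e2 := [seq X <- e1 | `[< E X >]].
pose psi i := if i \in r then phi i else phi1 i.
apply: (EF (e ++ e2) (r ++ r1) psi).
- move=> X; rewrite mem_cat mem_filter => /orP[/eE //|/andP[/asboolP //]].
- by move=> i; rewrite mem_cat => /orP[/rF //|/r1F []].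
apply: idealS (idealU eS J1) => x [xe xc].
have [Sx|nSx] := pselect (S x); [left|right].
  split=> //; split; first by move=> X Xe; apply: xe; rewrite /= mem_cat Xe.
  move=> i ir a ai; have := xc i; rewrite mem_cat ir /psi ir; exact.
split=> [X /= Xe1|i ir1 a ai].
  case: (e1E X Xe1) => [EX|->//]; apply: xe => /=.
  by rewrite mem_cat mem_filter Xe1 andbT orbC; apply/orP; left; apply/asboolP.
have [_ /= /negP/negbTE nir] := r1F i ir1.
by have := xc i; rewrite mem_cat ir1 orbT /psi nir; exact.
Qed.

(** On the layer of points that leave [initial_meet U] exactly at stage [m],
    this set is [A i a m], since the entries increase with [m]; quantifying over
    all later stages avoids naming the layer. *)
Definition layered (U : nat -> set nat) (i : K) (a : L) : set nat :=
  [set x | forall m, ~ initial_meet U m x -> A i a m x].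

Lemma layered_linked U i : linked_below J U (layered U i).
Proof.
move=> m s us ms; apply: idealS (linked_small AJ i us ms) => x [xV xU] a sa.
exact: xV.
Qed.

(** On [initial_meet U n] the intersection of [n] layered sets contains the
    intersection of the corresponding [n] entries of row [i] at level [n], so
    adding these sets costs no more than that row. *)
Lemma add_layered E F U i : F i ->
    (forall n, compatible J A (E `|` [set initial_meet U n]) F) ->
  compatible J A (E `|` range (layered U i)) (F `\ i).
Proof.
move=> Fi EUF e1 r1 phi1 e1E r1F J1.
pose e2 := [seq X <- e1 | `[< E X >]].
have [s sP] : exists s : seq L, forall X, X \in e1 ->
    E X \/ exists2 a, a \in s & X = layered U i a.
  elim: e1 e1E {J1 e2} => [|X e1 IH] XE; first by exists [::].
  have [|s sP] := IH; first by move=> Y Ye; apply: XE; rewrite inE Ye orbT.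
  case: (XE X (mem_head _ _)) => [EX|[a _ aX]].
    by exists s => Y; rewrite inE => /predU1P[->|/sP]; [left|].
  exists (a :: s) => Y; rewrite inE => /predU1P[->|/sP[|[b bs ->]]];
      [|by left|].
    by right; exists a; rewrite ?mem_head.
  by right; exists b; rewrite // inE bs orbT.
pose n := size s.
pose psi j := if j == i then s else phi1 j.
(* row [i] is no longer in [r1], so [psi] may spend it on the columns [s] *)
apply: (EUF n (initial_meet U n :: e2) (i :: r1) psi).
- move=> X; rewrite inE mem_filter => /predU1P[->|/andP[/asboolP]]; [by right|].
  by left.
- by move=> j; rewrite inE => /predU1P[->|/r1F []].
apply: idealS J1 => x [xe xc]; split=> [X Xe1|j jr1 a aj].
  case: (sP X Xe1) => [EX|[a sa ->] m nm].
    apply: xe; rewrite /= inE mem_filter Xe1 andbT orbC.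
    by apply/orP; left; apply/asboolP.
  have xn : initial_meet U n x by apply: xe; rewrite /= mem_head.
  have nm' : (n <= m)%N.
    rewrite leqNgt; apply/negP => /ltnW mn; apply: nm.
    exact: initial_meet_anti xn.
  apply: (linked_mono AJ nm').
  by have := xc i; rewrite mem_head /psi eqxx => /(_ isT); apply.
have [_ /= /eqP/negbTE ji] := r1F j jr1.
by have := xc j; rewrite inE jr1 orbT /psi ji; exact.
Qed.

(** Splitting on whether all the [initial_meet U n] can be added removes any
    need to know beforehand that [U] lies in the final filter, and hence to
    come back to the same sequence later. *)
Lemma decide_step E F U i : compatible J A E F -> F i ->
  exists E' (r : seq K), [/\ E `<=` E', compatible J A E' (F `\` [set` r]) &
                             decides J L E' U].
Proof.
move=> EF Fi.
have [EUF|] :=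
    pselect (forall n, compatible J A (E `|` [set initial_meet U n]) F).
  exists (E `|` range (layered U i)), [:: i]; split.
  - exact: subsetUl.
  - rewrite (_ : [set` [:: i]] = [set i]); first exact: add_layered.
    by apply/seteqP; split=> j /=; rewrite inE => /eqP.
  - right; exists (layered U i); last exact: layered_linked.
    by move=> a; right; exists a.
move=> /existsNP[n] nEU.
have [e [r [phi [eE rF eS]]]] : exists e r phi,
    [/\ sub_seq e E, sub_seq r F &
        J (finmeet e `&` cell A r phi `&` initial_meet U n)].
  apply: contrapT => none; apply: nEU => e r phi eE rF Je; apply: none.
  exists [seq X <- e | `[< E X >]], r, phi; split=> //.
    by move=> X; rewrite mem_filter => /andP[/asboolP].
  apply: idealS Je => x [[xe xc] xn]; split=> // X Xe.
  case: (eE X Xe) => [EX|->//]; apply: xe; rewrite /= mem_filter Xe andbT.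
  exact/asboolP.
exists (E `|` [set ~` initial_meet U n]), r; split.
- exact: subsetUl.
- exact: add_complement eS.
- by left; exists n; right.
Qed.

End Step.

(** * Transfinite recursion *)

Record strict_well_order (T : Type) (lt : T -> T -> Prop) : Prop :=
  StrictWellOrder {
    swo_wf : well_founded lt;
    swo_trans : forall s t u, lt s t -> lt t u -> lt s u;
    swo_total : forall s t, [\/ lt s t, s = t | lt t s] }.

Lemma wf_minimal (T : Type) (lt : T -> T -> Prop) (P : set T) t :
    well_founded lt -> P t ->
  exists2 m, P m & forall s, lt s m -> ~ P s.
Proof.
move=> wf; apply: contraPP => none; elim/(well_founded_ind wf): t => t IH Pt.
by apply: none; exists t.
Qed.

Lemma strict_well_order_exists (T : eqType) :
  exists lt : T -> T -> Prop, strict_well_order lt.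
Proof.
have [R Rwo] := wochoice.well_ordering_principle T.
have Rmin (s : seq T) x : x \in s ->
    exists2 z, z \in s & forall y, y \in s -> R z y.
  by move=> xs; have [|z [[zs zP] _]] := Rwo [in s]; [exists x|exists z].
have Rtot x y : R x y \/ R y x.
  have [z] := Rmin [:: x; y] x (mem_head _ _).
  rewrite !inE => /orP[]/eqP -> zP.
    by left; apply: zP; rewrite !inE eqxx orbT.
  by right; apply: zP; rewrite !inE eqxx.
have Ranti x y : R x y -> R y x -> x = y.
  move=> xy yx; have xx : R x x by case: (Rtot x x).
  have yy : R y y by case: (Rtot y y).
  have [|z [_ zP]] := Rwo [in [:: x; y]]; first by exists x; exact: mem_head.
  transitivity z; [symmetry|]; apply: zP; split.
  - exact: mem_head.
  - by move=> u; rewrite !inE => /orP[]/eqP ->.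
  - by rewrite !inE eqxx orbT.
  - by move=> u; rewrite !inE => /orP[]/eqP ->.
exists (fun x y => R x y /\ x <> y); split.
- move=> t; apply: contrapT => nacc.
  pose B := [pred x | `[< ~ Acc (fun x y => R x y /\ x <> y) x >]].
  have [|z [[zB zmin] _]] := Rwo B; first by exists t; apply/asboolP.
  move/asboolP: zB; apply; constructor => y [yz yNz]; apply: contrapT => ny.
  by apply: yNz; apply: Ranti => //; apply: zmin; apply/asboolP.
- move=> s t u [st sNt] [tu tNu].
  have su : R s u.
    have [z] := Rmin [:: s; t; u] s (mem_head _ _).
    rewrite !inE => /or3P[]/eqP -> zP.
    + by apply: zP; rewrite !inE eqxx !orbT.
    + by case: sNt; apply: Ranti => //; apply: zP; rewrite !inE eqxx.
    + by case: tNu; apply: Ranti => //; apply: zP; rewrite !inE eqxx ?orbT.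
  by split=> // us; case: sNt; apply: Ranti => //; rewrite us.
- move=> s t; have [->|/eqP st] := eqVneq s t; first by constructor 2.
  have [?|?] := Rtot s t; first by constructor 1.
  by constructor 3; split=> // /esym.
Qed.

(** A replacement for the initial ordinal of the cardinal of [Q]: cut a
    well-order of [Q] at the first point whose initial segment maps onto [Q],
    if there is one. *)
Lemma short_well_order (Q : eqType) :
  exists (T : Type) (lt : T -> T -> Prop) (e : T -> Q),
    [/\ strict_well_order lt, forall q, exists t, e t = q &
        forall t (h : T -> Q), exists q, forall s, lt s t -> h s <> q].
Proof.
have [lt ltwo] := strict_well_order_exists Q.
pose onto t := exists h : Q -> Q, forall q, exists2 s, lt s t & h s = q.
have [[t0 /(wf_minimal (swo_wf ltwo))[t [h hP] tmin]]|none] :=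
    pselect (exists t, onto t); last first.
  exists Q, lt, id; split=> //; first by move=> q; exists q.
  move=> t h; apply: contrapT => all; apply: none; exists t, h => q.
  apply: contrapT => nq; apply: all; exists q => s st hs.
  by apply: nq; exists s.
exists {s | lt s t}, (fun u v => lt (sval u) (sval v)), (fun u => h (sval u)).
split.
- split.
  + case=> u ut; move: (swo_wf ltwo u) ut; elim=> {}u _ IH ut.
    by constructor => -[v vt] /= vu; exact: IH.
  + by move=> u v w; exact: swo_trans.
  + move=> [u ut] [v vt] /=; have [?|uv|?] := swo_total ltwo u v.
    * by constructor 1.
    * by constructor 2; exact: eq_exist.
    * by constructor 3.
- by move=> q; have [s st hs] := hP q; exists (exist _ s st).
- case=> u ut k; apply: contrapT => all; apply: (tmin u ut).
  exists (fun s => if pselect (lt s t) is left st then k (exist _ s st) else s).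
  move=> q; apply: contrapT => nq; apply: all; exists q => -[s st] /= su ks.
  apply: nq; exists s => //; case: pselect => // st'.
  by rewrite -ks (Prop_irrelevance st' st).
Qed.

(** The values at earlier stages are passed as sets, empty or singletons, so
    that [step] does not depend on proofs of [lt s t]. *)
Lemma wf_recursion (T B : Type) (lt : T -> T -> Prop)
    (step : T -> (T -> set B) -> B) : well_founded lt ->
  exists G : T -> B, forall t,
    G t = step t (fun s => [set b | lt s t /\ b = G s]).
Proof.
move=> wf.
pose F t (h : forall s, lt s t -> B) : B :=
  step t (fun s => [set b | exists st : lt s t, b = h s st]).
exists (Fix wf (fun=> B) F) => t; rewrite Fix_eq; last first.
  move=> x f g fg; congr F; apply/functional_extensionality_dep => y.
  exact/functional_extensionality_dep.
congr step; apply/funext => s; apply/seteqP; split=> b.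
  by move=> [st ->].
by move=> [st ->]; exists st.
Qed.

Section Recursion.
Variables (J : set_ideal nat) (L : eqType).
Let K : Type := set (nat * (nat * nat)).
Variable A : K -> L -> nat -> set nat.
Hypothesis AJ : independent_linked J A.

(** Compatibility has finite character: finitely many generators already occur
    at one stage.  When there are no generators, this is the independence of
    the whole matrix, which also covers an empty [D]. *)
Lemma compatible_chain (T : Type) (lt : T -> T -> Prop) (D : set T)
    (E : T -> set (set nat)) (F : T -> set K) :
    strict_well_order lt ->
    (forall s t, D t -> lt s t -> E s `<=` E t) ->
    (forall s, D s -> compatible J A (E s) (F s)) ->
  compatible J A (\bigcup_(s in D) E s) (\bigcap_(s in D) F s).
Proof.
move=> ltwo Emono EF e r phi eE rF.
have [e0|[s Ds es]] : e = [::] \/ exists2 s, D s & sub_seq e (E s).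
  elim: e eE => [|X e IH] eE; first by left.
  right; have [s Ds Xs] := eE X (mem_head _ _).
  have [|->|[t Dt et]] := IH.
  - by move=> Y Ye; apply: eE; rewrite inE Ye orbT.
  - by exists s => // Y; rewrite inE => /eqP ->.
  have up u v : D u -> D v -> exists2 w, D w & E u `<=` E w /\ E v `<=` E w.
    move=> Du Dv; have [uv|->|vu] := swo_total ltwo u v.
    + by exists v => //; split=> //; exact: Emono.
    + by exists v; [|split].
    + by exists u => //; split=> //; exact: Emono.
  have [w Dw [sw tw]] := up s t Ds Dt.
  exists w => // Y; rewrite inE => /predU1P[->|/et]; [exact: sw|exact: tw].
rewrite e0 => Jc; apply: (linked_cell AJ (r := r) (phi := phi)).
  by apply: idealS Jc => x xc; split.
by apply: EF es _ => // i /rF; apply.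
Qed.

(** Stage [t] decides the sequence coded by [q t]. *)
Lemma exists_deciding_family : exists2 E : set (set nat),
  (forall e, sub_seq e E -> ~ J (finmeet e)) & forall U, decides J L E U.
Proof.
have [T [lt [q [ltwo q_onto q_short]]]] := short_well_order (set (nat * nat)).
pose U t n : set nat := [set m | q t (n, m)].
have stepP (y : set (set nat) * set K * (nat -> set nat)) :
    exists z : set (set nat) * seq K,
    compatible J A y.1.1 y.1.2 -> y.1.2 !=set0 ->
    [/\ y.1.1 `<=` z.1, compatible J A z.1 (y.1.2 `\` [set` z.2]) &
        decides J L z.1 y.2].
  have [[EF [i Fi]]|bad] :=
      pselect (compatible J A y.1.1 y.1.2 /\ y.1.2 !=set0).
    by have [E' [r rP]] := decide_step AJ y.2 EF Fi; exists (E', r).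
  by exists (set0, [::]) => EF F0; case: bad.
have [step {}stepP] := choice stepP.
pose before (P : T -> set (set (set nat) * seq K)) : set (set nat) * set K :=
  (\bigcup_t \bigcup_(z in P t) z.1,
   \bigcap_t \bigcap_(z in P t) ~` [set` z.2]).
have [G GE] := wf_recursion (fun t P => step (before P, U t)) (swo_wf ltwo).
pose E0 t := \bigcup_(s in lt^~ t) (G s).1.
pose F0 t := \bigcap_(s in lt^~ t) ~` [set` (G s).2].
have {}GE t : G t = step (E0 t, F0 t, U t).
  rewrite {1}GE; congr (step (_, _, _)).
    apply/seteqP; split=> [X [s _ [z [st ->]]]|X [s st sX]]; first by exists s.
    by exists s => //; exists (G s).
  apply/seteqP; split=> [i iP s st|i iP s _ z [st ->]]; last exact: iP.
  by apply: (iP s I (G s)).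
(* A row is a sequence of elements of [set (nat * nat)].  For each [n] some such
   element differs from the [n]-th component of the [n]-th row spent at every
   stage before [t]; the row [i] with these components was not spent. *)
have fresh t : F0 t !=set0.
  have [g gP] := choice (fun n =>
    q_short t (fun s => [set p | nth set0 (G s).2 n (n, p)])).
  pose i : K := [set p | g p.1 p.2].
  exists i => s st /= iG; apply: (gP (index i (G s).2) s st).
  by rewrite nth_index.
have EF0 t : compatible J A (E0 t) (F0 t).
  elim/(well_founded_ind (swo_wf ltwo)): t => t IH.
  (* each stage [s] before [t] already discarded the rows spent before [s] *)
  rewrite (_ : F0 t = \bigcap_(s in lt^~ t) (F0 s `\` [set` (G s).2])).
    apply: (compatible_chain ltwo) => [s u ut su X sX|s st].
      rewrite GE; have [+ _ _] := stepP (E0 u, F0 u, U u) (IH u ut) (fresh u).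
      by apply; exists s.
    by have [] := stepP (E0 s, F0 s, U s) (IH s st) (fresh s); rewrite -GE.
  apply/seteqP; split=> i iP s st; last by have [] := iP s st.
  by split; [move=> u us; apply: iP; exact: swo_trans st|exact: iP].
have GP t := stepP (E0 t, F0 t, U t) (EF0 t) (fresh t).
exists (\bigcup_t (G t).1) => [e eG Je|V].
  have := @compatible_chain T lt setT (fun t => (G t).1)
    (fun t => F0 t `\` [set` (G t).2]) ltwo.
  case/(_ _ _ e [::] (fun=> [::]))=> //.
  - by move=> s t _ st X sX; rewrite GE; have [+ _ _] := GP t; apply; exists s.
  - by move=> s _; have [] := GP s; rewrite -GE.
  - by apply: idealS Je => x [].
have [t qt] := q_onto [set p | V p.1 p.2].
have UV : U t = V by rewrite /U qt.
have [_ _] := GP t; rewrite -GE /= UV => -[[n nP]|[W WP WV]].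
  by left; exists n; exists t.
by right; exists W => // a; exists t.
Qed.

End Recursion.

(** * Points of the Stone space of a quotient algebra *)

Local Open Scope quotient_scope.

Section IdealDifference.
Variables (T : Type) (I : set_ideal T).
Implicit Types A B C : set T.

Lemma ideal_setD_trans B A C :
  I (A `\` B) -> I (B `\` C) -> I (A `\` C).
Proof.
move=> AB BC; apply: idealS (idealU AB BC) => x [Ax nCx].
by have [Bx|nBx] := pselect (B x); [right|left].
Qed.

End IdealDifference.

Section StoneQuotient.
Variables (T : Type) (J : set_ideal T).
Local Notation Q := (ideal_quot J).
Implicit Types (p : stone Q) (S : set T).

(** A point seen as an ultrafilter of sets, rather than of classes modulo
    [J]. *)
Definition in_point p S : Prop := stone_filter p (\pi_Q S).

Lemma pi_leP S S' : (\pi_Q S <= \pi_Q S' :> Q)%O <-> J (S `\` S').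
Proof.
rewrite -eq_meetl.
have -> : (Order.meet (\pi_Q S) (\pi_Q S') : Q) = \pi_Q (S `&` S').
  by rewrite -[LHS]/(iq_meet _ _) pi_iq_meet.
have sub : (S `&` S') `+` S = S `\` S'.
  apply/seteqP; split=> x /=; first by tauto.
  by move=> [Sx nS]; right; split=> // -[].
by rewrite -sub; split=> [/eqP/iq_eqP/asboolP|H] //; apply/eqP/iq_eqP/asboolP.
Qed.

Lemma in_pointS p S S' : J (S `\` S') -> in_point p S -> in_point p S'.
Proof. by move=> /pi_leP; exact: ultra_up (stone_ultra p) _ _. Qed.

Lemma in_pointI p S S' : in_point p S -> in_point p S' -> in_point p (S `&` S').
Proof.
move=> pS pS'; have := ultra_meet (stone_ultra p) pS pS'.
by rewrite -[Order.meet _ _]/(iq_meet _ _) -pi_iq_meet.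
Qed.

Lemma pi_setT : \top%O = \pi_Q setT :> Q.
Proof. by rewrite -[\top%O]/(iq_top J) /iq_top -lock. Qed.

Lemma pi_set0 : \bot%O = \pi_Q set0 :> Q.
Proof. by rewrite -[\bot%O]/(iq_bot J) /iq_bot -lock. Qed.

Lemma in_pointT p : in_point p setT.
Proof. by rewrite /in_point -pi_setT; exact: ultra_top (stone_ultra p). Qed.

Lemma in_point_ideal p S : J S -> ~ in_point p S.
Proof.
move=> JS pS; apply: (ultra_bot (stone_ultra p)); rewrite pi_set0.
by apply: in_pointS pS; rewrite setD0.
Qed.

Lemma in_point_bigI p (L : choiceType) (s : seq L) (V : L -> set T) :
  (forall a, a \in s -> in_point p (V a)) ->
  in_point p (\bigcap_(a in [set` s]) V a).
Proof.
elim: s => [|a s IH] sV.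
  apply: in_pointS (in_pointT p); apply: idealS (ideal0 J) => x [_]; apply.
  by move=> a.
have pa : in_point p (V a) by apply: sV; exact: mem_head.
have ps : in_point p (\bigcap_(b in [set` s]) V b).
  by apply: IH => b bs; apply: sV; rewrite inE bs orbT.
apply: in_pointS (in_pointI pa ps); apply: idealS (ideal0 J) => x [[xa xs]].
by apply=> b /=; rewrite inE => /predU1P[->|/xs].
Qed.

Lemma in_point_neq p q : q <> p -> exists2 S, in_point p S & ~ in_point q S.
Proof.
move=> qp; apply: contrapT => none; apply: qp.
have pq S : in_point p S -> in_point q S.
  by move=> pS; apply: contrapT => nqS; apply: none; exists S.
have qp S : in_point q S -> in_point p S.
  move=> qS; have [//|] := ultra_compl (stone_ultra p) (\pi_Q S).
  rewrite -[Order.compl _]/(iq_compl _) -pi_iq_compl => /pq qnS.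
  have := in_pointI qS qnS; rewrite setICr => /in_point_ideal; case.
  exact: ideal0.
have : stone_filter p = stone_filter q.
  by apply/seteqP; split=> x; rewrite -[x]reprK; [exact: pq|exact: qp].
case: p q {none pq qp} => [P up] [P' uq] /= PP'.
by subst P'; congr Stone; exact: Prop_irrelevance.
Qed.

(** A class belongs to the point when its representative is in the filter [gen]
    generated by [E] modulo [J]; this does not depend on the representative. *)
Lemma stone_point_of_base (E : set (set T)) :
    (forall e, sub_seq e E -> ~ J (finmeet e)) ->
    (forall S, exists2 e, sub_seq e E &
       J (finmeet e `\` S) \/ J (finmeet e `\` ~` S)) ->
  exists p, forall S, E S -> in_point p S.
Proof.
move=> EJ Edec.
pose gen S := exists2 e, sub_seq e E & J (finmeet e `\` S).
have genS S S' : J (S `\` S') -> gen S -> gen S'.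
  by move=> SS' [e eE eS]; exists e => //; exact: ideal_setD_trans SS'.
pose P : set Q := [set x | gen (repr x)].
have PE S : P (\pi_Q S) <-> gen S.
  have /iq_eqP/asboolP eS : \pi_Q S = \pi_Q (repr (\pi_Q S)) by rewrite reprK.
  by split; apply: genS; apply: idealS eS => x; [right|left].
have gen0 S : J S -> ~ gen S.
  move=> JS [e eE eS]; apply: (EJ e eE).
  apply: idealS (idealU eS JS) => x ex.
  by have [Sx|nSx] := pselect (S x); [right|left].
have genI S S' : gen S -> gen S' -> gen (S `&` S').
  move=> [e eE eS] [e' eE' eS']; exists (e ++ e').
    by move=> X; rewrite mem_cat => /orP[/eE|/eE'].
  apply: idealS (idealU eS eS') => x [xe nS].
  have [Sx|nSx] := pselect (S x).
    right; split; last by move=> S'x; apply: nS.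
    by move=> X /= Xe; apply: xe; rewrite /= mem_cat Xe orbT.
  by left; split=> // X /= Xe; apply: xe; rewrite /= mem_cat Xe.
have genT S : J (~` S) -> gen S.
  by move=> JS; exists [::] => //; apply: idealS JS => x [].
have up : is_ultrafilter P.
  split.
  - by rewrite pi_setT; apply/PE/genT; rewrite setCT; exact: ideal0.
  - by rewrite pi_set0 => /PE/gen0; apply; exact: ideal0.
  - elim/quotW=> S; elim/quotW=> S' /PE gS /PE gS'.
    by rewrite -[Order.meet _ _]/(iq_meet _ _) -pi_iq_meet; apply/PE/genI.
  - by elim/quotW=> S; elim/quotW=> S' /pi_leP SS' /PE gS; apply/PE/(genS S).
  - elim/quotW=> S; have [e eE [eS|eS]] := Edec S; [left|right].
      by apply/PE; exists e.
    rewrite -[Order.compl _]/(iq_compl _) -pi_iq_compl.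
    by apply/PE; exists e.
exists (Stone up) => S ES; apply/PE; exists [:: S].
  by move=> X; rewrite inE => /eqP ->.
apply: idealS (ideal0 J) => x [xS]; apply; apply: xS; exact: mem_head.
Qed.

End StoneQuotient.

(** * Weak P-points *)

Lemma open_stone_clopen d (B : ctbDistrLatticeType d) (a : B) :
  open (stone_clopen a).
Proof. by exists [set a : stone_index B]; rewrite ?bigcup_set1. Qed.

Lemma initial_meetS (U : nat -> set nat) n : initial_meet U n `<=` U n.
Proof. by move=> x; apply; exact: ltnSn. Qed.

Lemma uncountable_set_nat : ~ countable [set: set nat].
Proof.
move=> /countable_injP[f finj].
pose X : set nat := [set n | exists2 S, f S = n & ~ S n].
have [XfX|nX] := pselect (X (f X)).
  have [S fS nS] := XfX; apply: nS.
  by rewrite (finj S X) ?in_setT.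
by apply: (nX); exists X.
Qed.

Section WeakPPoint.
Variable J : set_ideal nat.
Local Notation Q := (ideal_quot J).

(** If [f q + 1] of the sets [V a] were in [q], then so would be their
    intersection, hence [U (f q)], which was chosen outside [q]. *)
Lemma weak_P_of_linked (p : stone Q) :
    (forall U, (forall n, in_point p (U n)) ->
       exists2 V : set nat -> set nat,
         forall a, in_point p (V a) & linked_below J U V) ->
  weak_P_point p.
Proof.
move=> pV D Dp /countable_injP[f finj] plim.
have sepP n : exists S, in_point p S /\
    forall q, D q -> f q = n -> ~ in_point q S.
  have [[q [Dq fq]]|none] := pselect (exists q, D q /\ f q = n).
    have [S pS qS] := in_point_neq (Dp q Dq); exists S; split=> // r Dr fr.
    by rewrite (finj r q) ?inE ?fr ?fq.
  exists setT; split; first exact: in_pointT.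
  by move=> q Dq fq; case: none; exists q.
have [U UP] := choice sepP.
have [V pVa UV] := pV U (fun n => (UP n).1).
have fin q : D q -> finite_set [set a | in_point q (V a)].
  move=> Dq; apply: contrapT => /(infinite_set_fset (f q).+1)[s sV ssz].
  apply: ((UP (f q)).2 q Dq erefl).
  have := in_point_bigI (p := q) (s := finmap.enum_fset s) (V := V) sV.
  apply: in_pointS; apply: idealS (UV (f q) _ (finmap.fset_uniq s) ssz).
  by move=> x [xV nU]; split=> // /initial_meetS.
have [a aP] : exists a, forall q, D q -> ~ in_point q (V a).
  apply: contrapT => all; apply: uncountable_set_nat.
  apply: (@sub_countable _ _ _ (\bigcup_(q in D) [set a | in_point q (V a)])).
    apply: subset_card_le => a _; apply: contrapT => na; apply: all; exists a.
    by move=> q Dq qa; apply: na; exists q.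
  apply: bigcup_countable; first by apply/countable_injP; exists f.
  by move=> q /fin /finite_set_countable.
have [|q [_ Dq qa]] := plim (stone_clopen (\pi_Q (V a))).
  by apply: open_nbhs_nbhs; split; [exact: open_stone_clopen|exact: pVa].
exact: (aP q Dq).
Qed.

(** Deciding the constant sequences makes [E] generate an ultrafilter; for a
    sequence of members of that ultrafilter, only the second alternative of
    [decides] is possible. *)
Lemma weak_P_of_deciding (E : set (set nat)) :
    (forall e, sub_seq e E -> ~ J (finmeet e)) ->
    (forall U, decides J (set nat) E U) ->
  exists p : stone Q, weak_P_point p.
Proof.
move=> EJ Edec.
have base S : exists2 e, sub_seq e E &
    J (finmeet e `\` S) \/ J (finmeet e `\` ~` S).
  have Sn n : initial_meet (fun=> S) n = S.
    by apply/seteqP; split=> [x /(_ n (ltnSn n))|x Sx j].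
  have e1 X : E X -> sub_seq [:: X] E by move=> EX Y; rewrite inE => /eqP ->.
  have f1 X x : finmeet [:: X] x -> X x by apply; exact: mem_head.
  have [[n]|[V VE VS]] := Edec (fun=> S).
    rewrite Sn => /e1 ES; exists [:: ~` S] => //; right.
    by apply: idealS (ideal0 J) => x [ex]; apply; exact: f1 ex.
  exists [:: V set0]; [exact: e1|left].
  have := VS 0 [:: set0] isT isT; rewrite Sn; apply: idealS => x [ex nS].
  by split=> // a /=; rewrite inE => /eqP ->; exact: f1 ex.
have [p pE] := stone_point_of_base EJ base.
exists p; apply: weak_P_of_linked => U pU.
have [[n /pE pn]|[V VE UV]] := Edec U; last first.
  by exists V => // a; apply: pE; exact: VE.
have pUn : in_point p (initial_meet U n).
  have := in_point_bigI (p := p) (s := iota 0 n.+1) (V := U) (fun j _ => pU j).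
  apply: in_pointS; apply: idealS (ideal0 J) => x [xU]; apply=> j /= jn.
  by apply: xU; rewrite -[_ j]/(is_true (j \in iota 0 n.+1)) mem_iota.
have := in_pointI pUn pn; rewrite setICr => /in_point_ideal[]; exact: ideal0.
Qed.

(** The same statement applies to every ideal with such a level map, for
    instance to the ideal of finite sets with the identity as level map. *)
Theorem weak_P_of_level (lvl : nat -> nat) :
    (forall S, finite_set S -> J (lvl @^-1` S)) ->
    (forall S, infinite_set S -> ~ J (lvl @^-1` S)) ->
  exists p : stone Q, weak_P_point p.
Proof.
move=> Jfin Jinf.
have [A AJ] := linked_family (nat * (nat * nat))%type nat Jfin Jinf.
have [E EJ Edec] := exists_deciding_family AJ.
exact: weak_P_of_deciding EJ Edec.
Qed.

End WeakPPoint.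

(** * The density ideal *)

Section Density.
Variable R : realType.
Local Open Scope ring_scope.

Lemma density0_bounded (S : set nat) k :
  (forall n, S n -> (n < k)%N) -> has_density S (0 : R).
Proof.
move=> Sk; apply/density_zeroP => e e0.
have card_le n : (#|[pred i : 'I_n | (i : nat) \in S]| <= k)%N.
  rewrite cardE -(size_map val) -[leqRHS](size_iota 0).
  apply: uniq_leq_size; first by rewrite (map_inj_uniq val_inj) enum_uniq.
  move=> _ /mapP[i + ->]; rewrite mem_enum => iS.
  by rewrite mem_iota; exact: Sk (set_mem iS).
near=> n.
have n0 : 0 < n%:R :> R by rewrite ltr0n; near: n; exact: nbhs_infty_gt.
rewrite /density_seq ler_pdivrMr// (@le_trans _ _ k%:R) ?ler_nat//.
by rewrite mulrC -ler_pdivrMr//; near: n; exact: nbhs_infty_ger.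
Unshelve. all: by end_near.
Qed.

(** The level [j] consists of the [2 ^ j] numbers from [2 ^ j] on, half of those
    below [2 ^ j.+1]. *)
Lemma density_level_ge (S : set nat) j :
  S j -> 2^-1 <= density_seq R (trunc_log 2 @^-1` S) (2 ^ j.+1)%N.
Proof.
move=> Sj; rewrite /density_seq ler_pdivlMr ?ltr0n ?expn_gt0//.
rewrite expnS natrM mulKf ?pnatr_eq0// ler_nat.
rewrite cardE -(size_map val) -[leqLHS](size_iota (2 ^ j)%N).
apply: uniq_leq_size; first exact: iota_uniq.
move=> i; rewrite mem_iota addnn -mul2n -expnS => /andP[ji ij].
apply/mapP; exists (Ordinal ij) => //; rewrite mem_enum; apply/mem_set => /=.
by rewrite (trunc_log_eq (n := j)) ?ji.
Qed.

Lemma density_level_finite (S : set nat) :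
  finite_set S -> has_density (trunc_log 2 @^-1` S) (0 : R).
Proof.
move=> /finite_fsetP[X ->].
pose b := \max_(j <- finmap.enum_fset X) j.
apply: (density0_bounded (k := (2 ^ b.+1)%N)) => n nX.
apply: leq_trans (@trunc_log_ltn 2 n isT) _.
by rewrite leq_exp2l// ltnS (leq_bigmax_seq _ nX).
Qed.

Lemma density_level_infinite (S : set nat) : infinite_set S ->
  ~ has_density (trunc_log 2 @^-1` S) (0 : R).
Proof.
move=> Sinf /density_zeroP /(_ 4^-1).
rewrite invr_gt0 ltr0n => /(_ isT)[N _ NP].
have [j Sj Nj] : exists2 j, S j & (N <= j)%N.
  apply: contrapT => none; apply: Sinf.
  apply: (sub_finite_set _ (finite_II N)) => j Sj /=; rewrite ltnNge.
  by apply/negP => Nj; apply: none; exists j.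
have Nn : (N <= 2 ^ j.+1)%N.
  by rewrite (leq_trans Nj)// (leq_trans (leqnSn j))// ltnW// ltn_expl.
have := le_trans (density_level_ge Sj) (NP _ Nn).
by rewrite lef_pV2 ?posrE ?ltr0n// ler_nat.
Qed.

End Density.

Theorem theorem1 (R : realType) :
  exists p : stone (ideal_quot (density_zero_ideal R)), weak_P_point p.
Proof.
apply: (weak_P_of_level (lvl := trunc_log 2)).
- exact: density_level_finite.
- exact: density_level_infinite.
Qed.
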